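(* Let $X$ be a $T_1$ topological space. Then $X$ is the open continuous image of a complete metric space (i.e. there is an open continuous surjection from a complete metric space onto $X$) if and only if Nonempty has a convergent winning strategy in the Choquet game $\mathsf{Ch}(X)$. Moreover, the metric space can be taken to have the same weight as $X$.
   Context: The Choquet game $\mathsf{Ch}(X)$ on a topological space $X$ is played by two players, Empty and Nonempty, for $\omega$ rounds. On round $i$, Empty moves first, choosing a point $x_i \in X$ and an open set $U_i$ with $x_i \in U_i$ and, if $i \geq 1$, $U_i \subseteq V_{i-1}$. Then Nonempty responds with an open set $V_i$ such that $x_i \in V_i \subseteq U_i$. Empty wins the play if $\bigcap_{n<\omega} V_n = \varnothing$; otherwise Nonempty wins. A strategy for Nonempty is a function $\mathfrak{S}$ which takes a partial play ending with a move by Empty and returns a legal open set for Nonempty to play. It is winning if Nonempty wins every play that follows it. It is convergent if for any play $\langle x_i,U_i,V_i\rangle_{i<\omega}$ following $\mathfrak{S}$, the collection $\{V_i : i<\omega\}$ is a neighborhood basis for any point in $\bigcap_i V_i$. (A convergent strategy need not be winning; a convergent winning strategy is one that is both.) The weight of a space is the least cardinality of a basis. *)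

(* Defs.v *)
From HB Require Import structures.
From mathcomp Require Import all_boot all_order all_algebra.
From mathcomp Require Import all_classical all_reals.
From mathcomp Require Import topology.

Set Implicit Arguments.
Unset Strict Implicit.
Unset Printing Implicit Defensive.

Local Open Scope classical_set_scope.
Local Open Scope card_scope.

Definition neighborhood_basis (X : topologicalType) (x : X)
    (B : set (set X)) : Prop :=
  (forall V, B V -> nbhs x V) /\
  (forall A, nbhs x A -> exists2 V, B V & V `<=` A).

Section ChoquetGame.
Variable X : topologicalType.

Definition empty_move : Type := X * set X.

(* The round ((x_i, U_i), V_i). *)
Definition round : Type := empty_move * set X.

(* V_(n-1) when h consists of n > 0 rounds; for n = 0 the value is setT, so
   that in the first round the inclusion constraint on U_0 is void. *)
Definition last_open (h : seq round) : set X := last setT (unzip2 h).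

Definition legal_empty (h : seq round) (m : empty_move) : Prop :=
  [/\ open m.2, m.2 m.1 & m.2 `<=` last_open h].

Definition legal_nonempty (m : empty_move) (V : set X) : Prop :=
  [/\ open V, V m.1 & V `<=` m.2].

Inductive legal_rounds : seq round -> Prop :=
| legal_rounds_nil : legal_rounds [::]
| legal_rounds_rcons (h : seq round) (r : round) :
    legal_rounds h -> legal_empty h r.1 -> legal_nonempty r.1 r.2 ->
    legal_rounds (rcons h r).

(* A partial play ending with a move by Empty is a pair (h, m) with
   legal_rounds h and legal_empty h m; the values of S elsewhere are
   irrelevant. *)
Definition nonempty_strategy (S : seq round -> empty_move -> set X) : Prop :=
  forall h m, legal_rounds h -> legal_empty h m -> legal_nonempty m (S h m).

Definition play (p : nat -> round) : Prop :=
  forall n, legal_rounds (mkseq p n).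

Definition follows (S : seq round -> empty_move -> set X)
    (p : nat -> round) : Prop :=
  play p /\ forall n, (p n).2 = S (mkseq p n) (p n).1.

Definition winning (S : seq round -> empty_move -> set X) : Prop :=
  forall p, follows S p -> \bigcap_n (p n).2 !=set0.

Definition convergent (S : seq round -> empty_move -> set X) : Prop :=
  forall p, follows S p -> forall x, (\bigcap_n (p n).2) x ->
    neighborhood_basis x (range (fun n => (p n).2)).

End ChoquetGame.

Definition has_convergent_winning_strategy (X : topologicalType) : Prop :=
  exists S : seq (round X) -> empty_move X -> set X,
    [/\ nonempty_strategy S, convergent S & winning S].

(* The library's complete spaces are pointed, hence nonempty; the empty metric
   space is allowed here. *)
Definition complete_metric (R : realType) (M : metricType R) : Prop :=
  forall u : nat -> M, cauchy (u @ \oo) -> exists l : M, u @ \oo --> l.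

Definition open_continuous_surjection (S T : topologicalType)
    (f : S -> T) : Prop :=
  [/\ continuous f, forall A, open A -> open (f @` A)
    & set_surj [set: S] [set: T] f].

(* The cardinality of K is the least cardinality of a basis of T. *)
Definition has_weight (T : topologicalType) (I : Type) (K : set I) : Prop :=
  (exists2 B : set (set T), basis B & B #= K) /\
  (forall B : set (set T), basis B -> K #<= B).

Definition same_weight (S T : topologicalType) : Prop :=
  exists K : set (set T), has_weight S K /\ has_weight T K.

(* Main.v *)
Require Import Defs.
From HB Require Import structures.
From mathcomp Require Import all_boot all_order all_algebra.
From mathcomp Require Import all_classical all_reals.
From mathcomp Require Import topology.

(* If f : M -> X is an open continuous surjection from a complete metric space,
   Nonempty answers with images of open sets of M whose diameters tend to 0 and
   whose closures are nested; their common point is mapped to the only point of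
   the intersection because X is T1.

   Conversely, fix a convergent winning strategy and a basis B of X of least
   cardinality. Consider the sequences W_0, W_1, ... in B for which there are
   plays following the strategy with W_n contained in V_n and U_{n+1} contained
   in W_n. With the metric of the first difference they form a complete space,
   and W |-> the point of the intersection of the W_n is continuous since the
   strategy is convergent, and maps the cylinder of a prefix ending with W_n
   onto W_n. There are at most |B| cylinders when B is infinite; when B is
   finite, X is discrete. *)

Set Implicit Arguments.
Unset Strict Implicit.
Unset Printing Implicit Defensive.

Import Order.TTheory GRing.Theory Num.Theory.

Local Open Scope classical_set_scope.
Local Open Scope card_scope.

(** * Cardinal arithmetic *)

Lemma inj_on_card_le (T U : Type) (A : set T) (B : set U) (f : T -> U) :
  (forall x, A x -> B (f x)) ->
  (forall x y, A x -> A y -> f x = f y -> x = y) -> A #<= B.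
Proof.
move=> fAB fI; have [g] : $|{injfun A >-> B}|.
  apply/injfunPex; exists f => //.
  by move=> x y /set_mem Ax /set_mem Ay; exact: fI.
exact: inj_card_le g.
Qed.

Lemma card_le_inj_on (T : Type) (U : pointedType) (A : set T) (B : set U) :
  A #<= B -> exists f : T -> U, (forall x, A x -> B (f x)) /\
    (forall x y, A x -> A y -> f x = f y -> x = y).
Proof.
move=> /pcard_leP/injfunPex[f fAB fI]; exists f; split => // x y Ax Ay.
by apply: fI; exact: mem_set.
Qed.

(* A maximal set of choice functions that is separated by every coordinate
   must exhaust one of the sets: otherwise another choice function avoiding
   all the values already taken could be added. *)
Lemma card_le_minimum (I : Type) (T : pointedType) (B : I -> set T) :
  inhabited I -> exists i, forall j, B i #<= B j.
Proof.
move=> [i0].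
pose P (F : set (I -> T)) := forall i,
  (forall u, F u -> B i (u i)) /\
  (forall u v, F u -> F v -> u i = v i -> u = v).
have [|F [PF Fmax]] := @Zorn_bigcup _ P.
  move=> C CP Ctot i; split=> [u [F CF Fu]|u v [F CF Fu] [G CG Gv]].
    exact: (CP _ CF i).1.
  by have [FG|GF] := Ctot _ _ CF CG; [apply: (CP _ CG i).2 => //; exact: FG|
    apply: (CP _ CF i).2 => //; exact: GF].
have [i Fi] : exists i, forall b, B i b -> exists2 u, F u & u i = b.
  apply: contrapT => /forallNP noi.
  have /choice[b bP] i : exists b, B i b /\ forall u, F u -> u i <> b.
    have /existsNP[b /not_implyP[Bb nb]] := noi i.
    by exists b; split=> // u Fu ub; apply: nb; exists u.
  have Fb : ~ F b by move=> /(bP i0).2.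
  apply: (Fmax (b |` F)).
    by split=> [u Fu|/(_ b)]; [right|move/(_ (or_introl erefl))].
  move=> i; split=> [u [->|Fu]|u v [->|Fu] [->|Fv]] //.
  - exact: (bP i).1.
  - exact: (PF i).1.
  - by move=> /esym /(bP i).2 - /(_ Fv).
  - by move=> /(bP i).2 - /(_ Fu).
  - exact: (PF i).2.
exists i => j.
have /choice[g gP] b : exists u, B i b -> F u /\ u i = b.
  have [Bb|nBb] := pselect (B i b); last by exists (fun=> point).
  by have [u Fu ub] := Fi _ Bb; exists u.
apply: (@inj_on_card_le _ _ _ _ (fun b => g b j)) => [b Bb|b c Bb Bc].
  by apply: (PF j).1; exact: (gP _ Bb).1.
move=> /((PF j).2 _ _ (gP _ Bb).1 (gP _ Bc).1) gbc.
by rewrite -(gP _ Bb).2 -(gP _ Bc).2 gbc.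
Qed.

(** A least member of the two-element family formed by [A] and [B] embeds into the other one. *)
Lemma card_le_total (T : pointedType) (A B : set T) : A #<= B \/ B #<= A.
Proof.
have [[] le] := card_le_minimum (fun b : bool => if b then A else B)
  (inhabits true).
- by left; exact: (le false).
- by right; exact: (le true).
Qed.

(** * Injections of the square of an infinite set into the set *)

Section Pairing.
Variable T : pointedType.
Implicit Types (A D E : set T) (p : T -> T -> T) (G : set (T * T * T)).

Definition pairing D E p :=
  (forall a b, D a -> D b -> E (p a b)) /\
  (forall a b a' b', D a -> D b -> D a' -> D b' ->
    p a b = p a' b' -> a = a' /\ b = b').

(* An element of [E] is encoded in [D] by tagging it with one of two elements
   of [D], according to whether it belongs to [D]. *)
Lemma pairing_extend D E p : infinite_set D -> pairing D D p ->
  E `\` D #<= D -> exists q, pairing E D q.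
Proof.
move=> Dinf [pD pI] /card_le_inj_on[k [kD kI]].
have /infiniteP/card_le_inj_on[e [eD eI]] := Dinf.
pose d0 := e 0; pose d1 := e 1.
have Dd0 : D d0 by exact: eD.
have Dd1 : D d1 by exact: eD.
have d01 : d0 <> d1 by move=> /eI - /(_ I I).
pose code x := if pselect (D x) then p d0 x else p d1 (k x).
have codeD x : E x -> D (code x).
  by rewrite /code => Ex; case: pselect => Dx; apply: pD => //; exact: kD.
have codeI x y : E x -> E y -> code x = code y -> x = y.
  rewrite /code => Ex Ey; case: pselect => Dx; case: pselect => Dy.
  - by move=> /pI[].
  - by move=> /pI[] //; exact: kD.
  - by move=> /pI[] //; [exact: kD|move=> /esym].
  - move=> /pI[] //; [exact: kD|exact: kD|].
    by move=> _ /kI; apply.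
exists (fun a b => p (code a) (code b)); split=> [a b Ea Eb|].
  by apply: pD; exact: codeD.
move=> a b a' b' Ea Eb Ea' Eb' /pI[]; try exact: codeD.
by move=> /codeI-> // /codeI->.
Qed.

Definition diag_dom G : set T := [set a | exists c, G (a, a, c)].

(* [G] is the graph of a pairing of [diag_dom G] with itself. *)
Definition pairing_graph A G :=
  [/\ diag_dom G `<=` A,
      (forall a b c, G (a, b, c) ->
        [/\ diag_dom G a, diag_dom G b & diag_dom G c]),
      (forall a b, diag_dom G a -> diag_dom G b -> exists c, G (a, b, c)),
      (forall a b c c', G (a, b, c) -> G (a, b, c') -> c = c') &
      (forall a b a' b' c, G (a, b, c) -> G (a', b', c) -> a = a' /\ b = b')].

(** Chain condition for Zorn's lemma: each clause involves at most two triples of the union, and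
    these lie in a common member of the chain. *)
Lemma pairing_graph_bigcup A (C : set (set (T * T * T))) :
  (forall G, C G -> pairing_graph A G) -> total_on C subset ->
  pairing_graph A (\bigcup_(G in C) G).
Proof.
move=> CP Ctot.
have up G H : C G -> C H -> exists2 K, C K & G `<=` K /\ H `<=` K.
  by move=> CG CH; have [GH|HG] := Ctot _ _ CG CH;
    [exists H => //; split|exists G => //; split]; move=> ? //; auto.
split.
- by move=> a [c [G CG Gac]]; have [GA _ _ _ _] := CP _ CG; apply: GA; exists c.
- move=> a b c [G CG Gabc]; have [_ Gd _ _ _] := CP _ CG.
  have [[x Gx] [y Gy] [z Gz]] := Gd _ _ _ Gabc.
  by split; [exists x|exists y|exists z]; exists G.
- move=> a b [c [G CG Ga]] [d [H CH Hb]].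
  have [K CK [GK HK]] := up _ _ CG CH.
  have [_ _ + _ _] := CP _ CK.
  move=> /(_ a b) []; [by exists c; exact: GK|by exists d; exact: HK|].
  by move=> x Kx; exists x; exists K.
- move=> a b c c' [G CG Ga] [H CH Hb]; have [K CK [GK HK]] := up _ _ CG CH.
  by have [_ _ _ + _] := CP _ CK; apply; [exact: GK Ga|exact: HK Hb].
- move=> a b a' b' c [G CG Ga] [H CH Hb]; have [K CK [GK HK]] := up _ _ CG CH.
  by have [_ _ _ _] := CP _ CK; apply; [exact: GK Ga|exact: HK Hb].
Qed.

Lemma pairing_graph_fun A G : pairing_graph A G ->
  exists2 p, pairing (diag_dom G) (diag_dom G) p &
    forall a b, diag_dom G a -> diag_dom G b -> G (a, b, p a b).
Proof.
move=> [_ Gd Gt Gf Gi].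
have /choice[p pP] (ab : T * T) : exists c,
    diag_dom G ab.1 -> diag_dom G ab.2 -> G (ab.1, ab.2, c).
  have [[da db]|nd] := pselect (diag_dom G ab.1 /\ diag_dom G ab.2).
    by have [c Gc] := Gt _ _ da db; exists c.
  by exists point => da db; case: nd.
exists (fun a b => p (a, b)) => [|a b]; last exact: pP (a, b).
split=> [a b da db|a b a' b' da db da' db' e].
  by have [] := Gd _ _ _ (pP (a, b) da db).
apply: Gi (pP (a, b) da db) _; rewrite e; exact: pP (a', b') da' db'.
Qed.

(** Seed for Zorn's lemma: a copy of [nat] in [A] inherits the coding of pairs of numbers by
    numbers. *)
Lemma pairing_graph_nat A (e : nat -> T) :
  (forall n, A (e n)) -> injective e ->
  pairing_graph A
    (range (fun ij : nat * nat => (e ij.1, e ij.2, e (pickle ij)))).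
Proof.
move=> eA eI; have dom n : diag_dom
    (range (fun ij : nat * nat => (e ij.1, e ij.2, e (pickle ij)))) (e n).
  by exists (e (pickle (n, n))); exists (n, n).
split.
- by move=> _ [c [ij _ [<- _ _]]].
- by move=> _ _ _ [ij _ [<- <- <-]].
- move=> _ _ [c [[i i'] _ [<- _ _]]] [d [[j j'] _ [<- _ _]]].
  by exists (e (pickle (i, j))); exists (i, j).
- by move=> _ _ _ _ [[i j] _ [<- <- <-]] [[i' j'] _ [/eI /= -> /eI /= -> <-]].
- move=> _ _ _ _ _ [[i j] _ [<- <- <-]] [[i' j'] _ [<- <- ]] /eI.
  by move=> /(pcan_inj pickleK)[-> ->].
Qed.

(* Otherwise the rest of [A] contains a copy of the domain [D], and the pairs
   of [D] together with this copy that are not in [D * D] can be sent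
   injectively into the copy, which extends [G]. *)
Lemma pairing_graph_max A G : pairing_graph A G ->
  infinite_set (diag_dom G) ->
  (forall H, G `<` H -> ~ pairing_graph A H) -> A `\` diag_dom G #<= diag_dom G.
Proof.
move=> Gok Dinf Gmax; set D := diag_dom G.
have [//|/card_le_inj_on[j [jA jI]]] := card_le_total (A `\` D) D.
have [p pD pG] := pairing_graph_fun Gok.
have [GA Gd Gt Gf Gi] := Gok.
pose E := D `|` j @` D.
have jDE : E `\` D #<= D.
  apply: (@card_le_trans _ _ _ (j @` D)); last exact: card_image_le.
  by apply: subset_card_le => x [[]].
have [q [qD qI]] := pairing_extend Dinf pD jDE.
pose H := G `|` [set abc | [/\ E abc.1.1, E abc.1.2,
  ~ (D abc.1.1 /\ D abc.1.2) & abc.2 = j (q abc.1.1 abc.1.2)]].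
have EH : diag_dom H = E.
  apply/seteqP; split=> [a [c [Gac|[]//]]|a Ea].
    by left; exists c.
  have [[c Ga]|nDa] := pselect (D a); first by exists c; left.
  by exists (j (q a a)); right; split=> //= -[].
have jE x : D x -> E (j x) by right; exists x.
have jND x : D x -> ~ D (j x) by move=> /jA[].
case: (Gmax H).
  split=> [|HG]; first by move=> x; left.
  have /infinite_setN0[d Dd] := Dinf.
  apply: (jND _ Dd); exists (j (q (j d) (j d))); apply: HG; right.
  by split=> /=; [exact: jE|exact: jE|by move=> [/(jND _ Dd) ?]|].
split; rewrite ?EH.
- by move=> x [/GA//|[y Dy <-]]; case: (jA _ Dy).
- move=> a b c [/Gd[da db dc]|[/= Ea Eb _ ->]]; first by split; left.
  by split=> //; apply: jE; exact: qD.
- move=> a b Ea Eb; have [[Da Db]|nD] := pselect (D a /\ D b).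
    by have [c Gc] := Gt _ _ Da Db; exists c; left.
  by exists (j (q a b)); right.
- move=> a b c c' [Gc|[/= Ea Eb nab ->]] [Gc'|[/= Ea' Eb' nab' ->]] //.
  + exact: Gf Gc Gc'.
  + by have [Da Db _] := Gd _ _ _ Gc; case: nab'.
  + by have [Da Db _] := Gd _ _ _ Gc'; case: nab.
- move=> a b a' b' c [Gc|[/= Ea Eb nab ->]] [Gc'|[/= Ea' Eb' nab' cE]] //.
  + exact: Gi Gc Gc'.
  + by have [_ _] := Gd _ _ _ Gc; rewrite cE => /(jND _ (qD _ _ Ea' Eb')).
  + by have [_ _ /(jND _ (qD _ _ Ea Eb))] := Gd _ _ _ Gc'.
  + by move: cE => /jI - /(_ (qD _ _ Ea Eb) (qD _ _ Ea' Eb')) /qI; apply.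
Qed.

Lemma infinite_pairing A : infinite_set A -> exists p, pairing A A p.
Proof.
move=> /infiniteP/card_le_inj_on[e [eA eI]].
have {}eI : injective e by move=> m n; exact: eI.
pose G0 := range (fun ij : nat * nat => (e ij.1, e ij.2, e (pickle ij))).
have G0ok : pairing_graph A G0.
  by apply: pairing_graph_nat => // n; exact: eA.
have [|G [[Gok G0G] Gmax]] := @Zorn_bigcup _
    [set G | pairing_graph A G /\ (G = set0 \/ G0 `<=` G)].
  move=> C CP Ctot; split; first by apply: pairing_graph_bigcup => // G /CP[].
  have [[G CG G0G]|nC] := pselect (exists2 G, C G & G0 `<=` G).
    by right=> x /G0G; exists G.
  left; rewrite -subset0 => x [G CG Gx]; have [_ [G0E|G0G]] := CP _ CG.
    by move: Gx; rewrite G0E.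
  by case: nC; exists G.
have {}G0G : G0 `<=` G.
  case: G0G => // GE; exfalso; apply: (Gmax G0); last by split=> //; right.
  rewrite GE; split=> // /(_ (e 0, e 0, e (pickle (0, 0)))).
  by apply; exists (0, 0).
have Dinf : infinite_set (diag_dom G).
  apply/infiniteP; apply: (@inj_on_card_le _ _ _ _ e) => [n _|m n _ _].
    by exists (e (pickle (n, n))); apply: G0G; exists (n, n).
  exact: eI.
have [p pD _] := pairing_graph_fun Gok.
have [GA _ _ _ _] := Gok.
have [|q [qD qI]] := @pairing_extend (diag_dom G) A p Dinf pD.
  apply: pairing_graph_max => // H GH Hok; apply: (Gmax H) => //; split=> //.
  by right; apply: subset_trans G0G _; exact: properW GH.
by exists q; split=> // a b Aa Ab; apply: GA; exact: qD.
Qed.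

End Pairing.

(** Folding the pairing over a sequence is injective only among sequences of equal length, so the
    code also records the length, as an element of [A]. *)
Lemma card_seq_le (T : pointedType) (A : set T) : infinite_set A ->
  [set s : seq T | forall x, x \in s -> A x] #<= A.
Proof.
move=> Ainf; have [p [pA pI]] := infinite_pairing Ainf.
have /infiniteP/card_le_inj_on[e [eA eI]] := Ainf.
pose fold := foldr p (e 0).
have foldA s : (forall x, x \in s -> A x) -> A (fold s).
  elim: s => [|x s IH] As /=; first exact: eA.
  apply: pA; first by apply: As; exact: mem_head.
  by apply: IH => y ys; apply: As; rewrite inE ys orbT.
have foldI s t : (forall x, x \in s -> A x) ->
    (forall x, x \in t -> A x) -> size s = size t -> fold s = fold t -> s = t.
  elim: s t => [|x s IH] [|y t] //= As At [st].
  have As' z : z \in s -> A z by move=> zs; apply: As; rewrite inE zs orbT.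
  have At' z : z \in t -> A z by move=> zt; apply: At; rewrite inE zt orbT.
  move=> /pI[];
    [exact/As/mem_head|exact: foldA|exact/At/mem_head|exact: foldA|].
  by move=> -> /(IH _ As' At' st) ->.
apply: (@inj_on_card_le _ _ _ _ (fun s => p (e (size s)) (fold s)))
  => [s As|s t As At].
  by apply: pA; [exact: eA|exact: foldA].
move=> /pI[]; [exact: eA|exact: foldA|exact: eA|exact: foldA|].
by move=> /eI - /(_ I I); exact: foldI.
Qed.

(** * Spaces of sequences *)

Lemma exp2V_lt (R : realType) (e : R) : (0 < e)%R ->
  exists n, (2 ^- n < e :> R)%R.
Proof.
move=> e0; exists (Num.bound e^-1)%R.
rewrite -[ltRHS]invrK ltf_pV2 ?posrE ?invr_gt0 ?exprn_gt0//.
exact: upper_nthrootP.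
Qed.

Definition agree (T : Type) (n : nat) (v w : nat -> T) : Prop :=
  forall k, k < n -> v k = w k.

(* The field [R] is a phantom parameter, in which the distance takes its
   values. *)
Definition seq_space (R : realType) (T : Type) (P : set (nat -> T)) : Type :=
  {w | P w}.

Section SeqSpace.
Variables (R : realType) (T : Type) (P : set (nat -> T)).
Local Notation M := (seq_space R P).
Local Open Scope ring_scope.

HB.instance Definition _ := gen_eqMixin M.
HB.instance Definition _ := gen_choiceMixin M.

Let differ (v w : M) := fun n => ~~ `[<sval v n = sval w n>].

Definition seq_dist (v w : M) : R :=
  if pselect (exists n, differ v w n) is left h then 2 ^- ex_minn h else 0.

(** The inequality is strict, so the first difference lies beyond index [n]; this reduces metric
    statements to prefixes. *)
Lemma seq_dist_lt n (v w : M) :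
  seq_dist v w < 2 ^- n <-> agree n.+1 (sval v) (sval w).
Proof.
rewrite /seq_dist; case: pselect => [h|nh]; last first.
  split=> _; last by rewrite invr_gt0 exprn_gt0.
  by move=> k _; apply: contrapT => /asboolPn vw; apply: nh; exists k.
case: ex_minnP => m /asboolPn vw mmin.
rewrite ltf_pV2 ?posrE ?exprn_gt0// ltr_eXn2l ?ltr1n//.
split=> [nm k kn|]; last first.
  move=> a; rewrite ltnNge; apply/negP => mn; apply: vw.
  exact: a.
apply: contrapT => /asboolPn /mmin mk.
by move: (leq_trans nm mk); rewrite leqNgt kn.
Qed.

Lemma seq_dist_cases (v w : M) :
  sval v = sval w /\ seq_dist v w = 0 \/
  exists n, sval v n <> sval w n /\ seq_dist v w = 2 ^- n.
Proof.
rewrite /seq_dist; case: pselect => [h|nh].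
  by right; case: ex_minnP => m /asboolPn vw mmin; exists m.
left; split=> //; apply/funext => k; apply: contrapT => /asboolPn vw.
by apply: nh; exists k.
Qed.

Let seq_distxx v : seq_dist v v = 0.
Proof. by have [[]|[n []]] := seq_dist_cases v v. Qed.

Let seq_dist_eq0 v w : seq_dist v w = 0 -> v = w.
Proof.
have [[vw _] _|[n [_ ->]]] := seq_dist_cases v w.
  by case: v w vw => [v Pv] [w Pw] /= vw; exact: eq_exist.
by move=> /eqP; rewrite invr_eq0 expf_eq0 pnatr_eq0 andbF.
Qed.

Let seq_distC v w : seq_dist v w = seq_dist w v.
Proof.
rewrite /seq_dist; have -> : differ v w = differ w v; last by [].
apply/funext => n; congr (~~ _); apply/asbool_equiv_eq.
by split=> ->.
Qed.

Let seq_dist_ge0 v w : 0 <= seq_dist v w.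
Proof.
have [[_ ->//]|[n [_ ->]]] := seq_dist_cases v w.
by rewrite invr_ge0 exprn_ge0.
Qed.

Let seq_dist_triangle v u w : seq_dist u w <= seq_dist u v + seq_dist v w.
Proof.
have [[_ ->]|[n [uw ->]]] := seq_dist_cases u w; first exact: addr_ge0.
(* If both summands were below [2 ^- n], all three sequences would agree at index [n], where [u] and
   [w] differ. *)
have [uv|/seq_dist_lt uv] := leP (2 ^- n) (seq_dist u v).
  by rewrite (le_trans uv)// lerDl.
have [vw|/seq_dist_lt vw] := leP (2 ^- n) (seq_dist v w).
  by rewrite (le_trans vw)// lerDr.
by case: uw; rewrite uv// vw.
Qed.

HB.instance Definition _ := isMetric.Build R M
  seq_distxx seq_dist_eq0 seq_distC seq_dist_triangle.

Lemma nbhs_seq_space (w : M) (A : set M) :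
  nbhs w A <-> exists n, [set v : M | agree n (sval w) (sval v)] `<=` A.
Proof.
split=> [/nbhs_ballP[e /exp2V_lt[n ne] eA]|[n nA]].
  exists n.+1 => v /seq_dist_lt wv; apply: eA; rewrite ballEmdist.
  exact: lt_trans wv ne.
apply/nbhs_ballP; exists (2 ^- n); first by rewrite /= invr_gt0 exprn_gt0.
move=> v; rewrite ballEmdist => /seq_dist_lt wv; apply: nA => k kn.
by apply: wv; exact: ltnW.
Qed.

(** The hypothesis says that [P] is closed among all sequences. Along a Cauchy sequence each
    coordinate is eventually constant, which gives the limit. *)
Lemma seq_space_complete :
  (forall w, (forall n, exists2 v, P v & agree n w v) -> P w) ->
  complete_metric M.
Proof.
move=> Pclosed u /cauchy_ballP uc.
have /choice[N NP] n : exists N, forall k, (N <= k)%N ->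
    agree n (sval (u N)) (sval (u k)).
  have e0 : 0 < 2 ^- n :> R by rewrite invr_gt0 exprn_gt0.
  have [[A B] /= [[i _ iA] [j _ jB]] AB] := uc _ e0.
  exists (maxn i j) => k kij.
  have := AB (u (maxn i j), u k); rewrite /= ballEmdist => /(_ _)/seq_dist_lt.
  move=> + l ln; apply; last exact: ltnW.
  split=> /=; [apply: iA|apply: jB]; rewrite /= ?leq_maxl//.
  by rewrite (leq_trans _ kij)// leq_maxr.
pose l k := sval (u (N k.+1)) k.
(* [N] need not be monotone, so the stage that fixes the first [n] coordinates is a maximum. *)
pose K n := (\max_(m < n.+1) N m)%N.
have KP n k : (K n <= k)%N -> agree n l (sval (u k)).
  move=> Kk m mn; rewrite /l; apply: NP => //; apply: leq_trans Kk.
  exact: (leq_bigmax (Ordinal (mn : (m.+1 < n.+1)%N))).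
have Pl : P l.
  by apply: Pclosed => n; exists (sval (u (K n))); [exact: svalP|exact: KP].
exists (exist _ l Pl) => A /nbhs_seq_space[n nA].
by exists (K n) => // k /= /KP uk; exact: nA.
Qed.

End SeqSpace.

(** * From complete metric spaces to strategies *)

Section Game.
Variable X : topologicalType.
Implicit Types (h : seq (round X)) (p : nat -> round X).

Lemma last_open_rcons h (r : round X) : last_open (rcons h r) = r.2.
Proof. by rewrite /last_open /unzip2 map_rcons last_rcons. Qed.

Lemma legal_rounds_rconsP h (r : round X) : legal_rounds (rcons h r) ->
  [/\ legal_rounds h, legal_empty h r.1 & legal_nonempty r.1 r.2].
Proof.
move=> hr; inversion hr as [eq|h' r' Lh Le Ln eq].
  by move/(congr1 size): eq; rewrite size_rcons.
by move/rcons_inj : eq => [<- <-].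
Qed.

Lemma play_legal p n : play p ->
  legal_empty (mkseq p n) (p n).1 /\ legal_nonempty (p n).1 (p n).2.
Proof. by move=> /(_ n.+1); rewrite mkseqS => /legal_rounds_rconsP[]. Qed.

End Game.

Section StrategyFromCompleteMetric.
Variables (R : realType) (X : topologicalType) (M : metricType R) (f : M -> X).
Hypotheses (hX : accessible_space X) (Mcomplete : complete_metric M)
  (fP : open_continuous_surjection f).
Implicit Types (W : set M) (m : empty_move X) (h : seq (round X)).

(* The strategy answers [m] with the image of a set [W'] such that
   [shrinks n W m W'], where [W] is the set whose image was the previous
   answer. *)
Let shrinks (n : nat) W m W' := [/\ open W', (f @` W') m.1, closure W' `<=` W,
  f @` W' `<=` m.2 & forall a b, W' a -> W' b -> ball a (2 ^- n : R)%R b].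

Let shrink n W m := xget set0 (shrinks n W m).

(** By regularity, a preimage in [W] of Empty's point has a neighborhood whose closure stays in [W]
    and in the preimage of [m.2]; a ball of half the radius bounds distances. *)
Let shrinkP n W m : open W -> open m.2 -> (f @` W) m.1 -> m.2 m.1 ->
  shrinks n W m (shrink n W m).
Proof.
have [fc fo fs] := fP.
move=> oW oU [y Wy fy] Uy; apply: xgetPex.
have nU : nbhs y (W `&` f @^-1` m.2).
  apply: open_nbhs_nbhs; split; last by rewrite /= fy.
  by apply: openI => //; apply: open_comp => // x _; exact: fc.
have [N yN NU] := uniform_regular nU.
have e0 : (0 < 2 ^- n / 2 :> R)%R by rewrite divr_gt0// invr_gt0 exprn_gt0.
pose W' := (N `&` ball y (2 ^- n / 2 : R)%R)^°.
have W'y : W' y.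
  apply: nbhs_singleton; apply: nbhs_interior; apply: filterI => //.
  exact: nbhsx_ballx.
have W'N : W' `<=` N by move=> z /interior_subset[].
have W'U : closure W' `<=` W `&` f @^-1` m.2.
  by apply: subset_trans NU; exact: closureS.
exists W'; split.
- exact: open_interior.
- by exists y.
- by move=> z /W'U[].
- by move=> _ [z /subset_closure/W'U[_ Uz] <-].
- move=> a b /interior_subset[_ ya] /interior_subset[_ yb].
  by rewrite [X in ball _ X _]splitr; apply: ball_triangle yb; exact: ball_sym.
Qed.

(** A history records only data in [X]; replaying it recovers the round number and the subset of [M]
    behind the last answer. *)
Let state h := foldl (fun st (r : round X) =>
  (st.1.+1, shrink st.1 st.2 r.1)) (0, [set: M]) h.

(** The fallback [m.2] keeps the strategy legal on legal histories that do not follow it. *)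
Let answer n W m : set X :=
  if pselect (shrinks n W m (shrink n W m)) then f @` shrink n W m else m.2.

Let strategy h m := answer (state h).1 (state h).2 m.

Let strategy_legal : nonempty_strategy strategy.
Proof.
have [fc fo fs] := fP.
move=> h m _ [om mm _]; rewrite /strategy /answer.
case: pselect => /= [[oW Wm _ Wm2 _]|_]; last by split.
by split=> //; exact: fo.
Qed.

Section Play.
Variable p : nat -> round X.
Hypothesis pP : follows strategy p.

Let W n := (state (mkseq p n)).2.

Let state_fst n : (state (mkseq p n)).1 = n.
Proof. by elim: n => // n; rewrite mkseqS /state foldl_rcons /= => ->. Qed.

Let W_S n : W n.+1 = shrink n (W n) (p n).1.
Proof. by rewrite /W mkseqS /state foldl_rcons /= -/(state _) state_fst. Qed.

(** Empty's next point therefore has a preimage in [W n], so the fallback answer never occurs along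
    [p]. *)
Let W_invariant n : open (W n) /\ f @` W n = last_open (mkseq p n).
Proof.
have [fc fo fs] := fP; have [pplay pS] := pP.
elim: n => [|n [oW fW]].
  split; first exact: openT.
  by apply/seteqP; split=> // x _; have [//|y _ <-] := fs x; exists y.
have [[oU Ux UV] _] := play_legal n pplay.
have sh : shrinks n (W n) (p n).1 (shrink n (W n) (p n).1).
  by apply: shrinkP => //; rewrite fW; exact: UV.
rewrite W_S mkseqS last_open_rcons pS /strategy /answer state_fst -/(W n).
by case: pselect => /= [_|[]//]; split=> //; case: sh.
Qed.

Let W_shrinks n : shrinks n (W n) (p n).1 (W n.+1).
Proof.
have [pplay _] := pP; have [oW fW] := W_invariant n.
have [[oU Ux UV] _] := play_legal n pplay.
by rewrite W_S; apply: shrinkP => //; rewrite fW; exact: UV.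
Qed.

Let answerE n : (p n).2 = f @` W n.+1.
Proof. by have [_ ->] := W_invariant n.+1; rewrite mkseqS last_open_rcons. Qed.

Let W_decr k n : k <= n -> W n `<=` W k.
Proof.
elim: n => [|n IH]; first by rewrite leqn0 => /eqP->.
rewrite leq_eqVlt => /predU1P[->//|/IH kn]; apply: subset_trans kn.
by have [_ _ + _ _] := W_shrinks n; apply: subset_trans; exact: subset_closure.
Qed.

Let W_limit : exists l, forall n, W n l.
Proof.
have /choice[y yP] n : exists y, W n y.
  have [_ [y Wy _] _ _ _] := W_shrinks n; exists y.
  exact: W_decr Wy.
have [|l yl] := Mcomplete (u := y).
  apply/cauchy_ballP => e /exp2V_lt[n ne].
  exists (W n.+1, W n.+1).
    by split; exists n.+1 => // k /= nk; exact: W_decr (yP k).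
  move=> [a b] [/= Wa Wb]; have [_ _ _ _ Wball] := W_shrinks n.
  by apply: le_ball (ltW ne) _ _; exact: Wball.
(* The limit lies in the closure of [W n.+1], hence in [W n]. *)
exists l => n; have [_ _ + _ _] := W_shrinks n; apply.
move=> A /yl [N _ NA]; exists (y (maxn N n.+1)); split.
  by apply: W_decr (yP _); exact: leq_maxr.
by apply: NA => /=; exact: leq_maxl.
Qed.

(** Continuity of [f] at the common point of the [W n] makes the answers shrink to its image;
    winning and convergence both follow from this. *)
Lemma play_limit : exists2 x, (\bigcap_n (p n).2) x &
  forall A, nbhs x A -> exists n, (p n).2 `<=` A.
Proof.
have [fc fo fs] := fP; have [l lW] := W_limit; exists (f l).
  by move=> n _; rewrite answerE; exists l.
move=> A /fc /nbhs_ballP[e /exp2V_lt[n ne] eA]; exists n.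
rewrite answerE => _ [z Wz <-]; apply: eA.
have [_ _ _ _ Wb] := W_shrinks n.
by apply: le_ball (ltW ne) _ _; exact: Wb.
Qed.

Lemma play_nbhs_basis x : (\bigcap_n (p n).2) x ->
  neighborhood_basis x (range (fun n => (p n).2)).
Proof.
have [l lV lA] := play_limit => xV.
have -> : x = l.
  apply/eqP; apply: contrapT => /negP; rewrite eq_sym => /hX.
  move=> [A [oA /set_mem Al /set_mem]].
  have [|n nA] := lA A; first exact: open_nbhs_nbhs.
  by apply; apply: nA; exact: xV.
split=> [_ [n _ <-]|A /lA[n nA]]; last by exists (p n).2 => //; exists n.
have [_ [oV _ _]] := play_legal n pP.1.
by apply: open_nbhs_nbhs; split=> //; exact: lV.
Qed.

End Play.

Lemma complete_metric_strategy : has_convergent_winning_strategy X.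
Proof.
exists strategy; split; first exact: strategy_legal.
- by move=> p pP x; exact: play_nbhs_basis.
- by move=> p /play_limit[x xV _]; exists x.
Qed.

End StrategyFromCompleteMetric.

(** * Weight *)

Lemma basis_nbhs (T : topologicalType) (B : set (set T)) x (A : set T) :
  basis B -> nbhs x A -> exists U, [/\ B U, U x & U `<=` A].
Proof. by move=> [_ Bx] /Bx[U [BU Ux] UA]; exists U. Qed.

Lemma nbhs_basis (T : topologicalType) (B : set (set T)) : B `<=` open ->
  (forall x A, nbhs x A -> exists U, [/\ B U, U x & U `<=` A]) -> basis B.
Proof. by move=> Bo Bn; split=> // x A /Bn[U [BU Ux UA]]; exists U. Qed.

Lemma exists_minimum_basis (X : topologicalType) : exists B : set (set X),
  basis B /\ forall B' : set (set X), basis B' -> B #<= B'.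
Proof.
have oB : basis (@open X).
  apply: nbhs_basis => // x A; rewrite nbhsE => -[U [oU Ux] UA].
  by exists U.
have [[B bB] Bmin] := card_le_minimum
  (fun B : {B : set (set X) | basis B} => sval B) (inhabits (exist _ _ oB)).
by exists B; split=> // B' bB'; exact: Bmin (exist _ B' bB').
Qed.

(** The images of the members of a basis of [S] form a basis of [X], so no basis of [S] is smaller
    than [B]. *)
Lemma same_weight_image (S X : topologicalType) (f : S -> X)
    (B : set (set X)) (C : set (set S)) :
  open_continuous_surjection f ->
  basis B -> (forall B' : set (set X), basis B' -> B #<= B') ->
  basis C -> C #<= B -> same_weight S X.
Proof.
move=> [fc fo fs] bB Bmin bC CB.
have min (C' : set (set S)) : basis C' -> B #<= C'.
  move=> bC'; have [C'o _] := bC'.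
  apply: (@card_le_trans _ _ _ (image^~ f @` C')); last exact: card_image_le.
  apply: Bmin; apply: nbhs_basis => [_ [U /C'o oU <-]|x A xA]; first exact: fo.
  have [//|y _ yx] := fs x.
  have /(basis_nbhs bC')[U [C'U Uy UA]] : nbhs y (f @^-1` A).
    by apply: fc; rewrite yx.
  exists (f @` U); split; [by exists U|by exists y|].
  by move=> _ [z /UA ? <-].
exists B; split; split=> //.
- by exists C => //; apply/card_eqPle; split=> //; exact: min.
- by exists B => //; exact: card_eqxx.
Qed.

Lemma finite_basis_discrete (X : topologicalType) (B : set (set X)) :
  accessible_space X -> basis B -> finite_set B -> forall x : X, open [set x].
Proof.
move=> hX bB /finite_fsetP[F BF] x.
rewrite openE => _ ->; change (nbhs x [set x]).
(* This is the intersection of the finitely many basis members containing [x]; the T1 axiom reduces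
   it to [x]. *)
suff : nbhs x (\bigcap_(U in B) [set y : X | U x -> U y]).
  apply: filterS => y Uy; apply/eqP; apply: contrapT => /negP.
  rewrite eq_sym => /hX [A [oA /set_mem Ax /set_mem]]; apply.
  have [U [BU Ux UA]] := basis_nbhs bB (open_nbhs_nbhs (conj oA Ax)).
  by apply: UA; exact: Uy.
rewrite [X in \bigcap_(_ in X) _]BF; apply: filter_bigI => U UF.
have BU : B U by rewrite BF.
have [Ux|nUx] := pselect (U x); last by apply: filterE => y /nUx.
have oU := bB.1 _ BU.
by apply: filterS (open_nbhs_nbhs (conj oU Ux)) => y Uy _.
Qed.

(** * From strategies to complete metric spaces *)

Section Discrete.
Variables (R : realType) (X : topologicalType).
Hypothesis discr : forall x : X, open [set x].

(** Distinct constant sequences already differ at index 0, so they carry a discrete metric and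
    evaluation at 0 is a homeomorphism. *)
Lemma discrete_metric_image (B : set (set X)) : basis B ->
  (forall B' : set (set X), basis B' -> B #<= B') ->
  exists (M : metricType R) (f : M -> X),
    [/\ complete_metric M, open_continuous_surjection f & same_weight M X].
Proof.
move=> bB Bmin; pose P (w : nat -> X) := forall n, w n = w 0.
pose f (w : seq_space R P) := sval w 0.
have fI : injective f.
  move=> [v Pv] [w Pw]; rewrite /f /= => vw; apply: eq_exist.
  by apply/funext => n; rewrite Pv Pw.
have fc : continuous f.
  move=> w A /nbhs_singleton Aw; apply/nbhs_seq_space; exists 1 => v wv.
  by rewrite /preimage /= /f -wv.
have fP : open_continuous_surjection f.
  split=> // [A _|x _].
    rewrite openE => x Ax.
    by apply: filterS (open_nbhs_nbhs (conj (discr x) erefl)) => _ ->.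
  by exists (exist P (fun=> x) (fun=> erefl)).
exists (seq_space R P), f; split=> //.
  apply: seq_space_complete => w wP n.
  by have [v Pv wv] := wP n.+1; rewrite wv// Pv wv.
apply: (same_weight_image fP bB Bmin (C := [set f @^-1` U | U in B])).
  apply: nbhs_basis => [_ [U /bB.1 oU <-]|w A wA].
    by apply: open_comp => // x _; exact: fc.
  have [U [BU Uw Uf]] :=
    basis_nbhs bB (open_nbhs_nbhs (conj (discr (f w)) erefl)).
  exists (f @^-1` U); split=> //; first by exists U.
  by move=> v /Uf /fI ->; exact: nbhs_singleton.
exact: card_image_le.
Qed.

End Discrete.

(* The points of the metric space are sequences of members of a basis [B]
   along which some legal moves of Empty make the strategy answer with sets
   containing the successive members. A prefix determines chosen moves, hence
   a single play, so that there are no more cylinders than finite sequences in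
   [B]; letting the sequences record the moves themselves would not bound the
   weight, as [X] may have more points than [B] has members. *)
Section MetricFromStrategy.
Variables (R : realType) (X : topologicalType) (x0 : X).
Variable S : seq (round X) -> empty_move X -> set X.
Variable B : set (set X).
Hypotheses (hX : accessible_space X) (Slegal : nonempty_strategy S)
  (Sconv : convergent S) (Swin : winning S) (bB : basis B).
Implicit Types (st : seq (round X) * set X) (W : set X) (w v : nat -> set X).

(** [st] holds the history and the last basis member. Empty must move inside that member, so that
    answers and basis members interleave. *)
Let good st W (m : empty_move X) :=
  [/\ open m.2, m.2 m.1, m.2 `<=` st.2 & W `<=` S st.1 m].

Let admissible st W := B W /\ exists m, good st W m.

Let move st W : empty_move X := xget (x0, setT) (good st W).

Let next_round st W : round X := (move st W, S st.1 (move st W)).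

Let update st W := (rcons st.1 (next_round st W), W).

Let Fixpoint state w n : seq (round X) * set X :=
  if n is k.+1 then update (state w k) (w k) else ([::], [set: X]).

Let valid w := forall n, admissible (state w n) (w n).

Let legal_state st :=
  [/\ legal_rounds st.1, open st.2 & st.2 `<=` last_open st.1].

Let move_good st W : admissible st W -> good st W (move st W).
Proof. by move=> [_]; exact: xgetPex. Qed.

Let legal_update st W : legal_state st -> admissible st W ->
  legal_state (update st W).
Proof.
move=> [Lst ost stV] aW; have [oU Ux Ust WS] := move_good aW.
have le : legal_empty st.1 (move st W).
  by split=> //; apply: subset_trans stV.
split=> /=; last by rewrite last_open_rcons.
  by apply: legal_rounds_rcons => //; exact: Slegal.
exact: (bB.1 _ aW.1).
Qed.

Let legal_state0 w : legal_state (state w 0).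
Proof. by split; [exact: legal_rounds_nil|exact: openT|move=> x]. Qed.

(* Empty may play the pair of [x] and the whole current set. *)
Let admissible_exists st x : legal_state st -> st.2 x ->
  exists2 W, admissible st W & W x.
Proof.
move=> [Lst ost stV] stx.
have [oV Vx _] : legal_nonempty (x, st.2) (S st.1 (x, st.2)) by exact: Slegal.
have [W [BW Wx WV]] := basis_nbhs bB (open_nbhs_nbhs (conj oV Vx)).
by exists W => //; split=> //; exists (x, st.2); split=> // y.
Qed.

Let state_agree n w v : agree n w v -> state w n = state v n.
Proof.
elim: n => //= n IH wv; rewrite IH ?wv// => k kn.
by apply: wv; exact: ltnW.
Qed.

Let legal_state_valid w n : valid w -> legal_state (state w n).
Proof.
move=> vw; elim: n => [|n IH]; first exact: (legal_state0 w).
exact: legal_update.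
Qed.

Let induced_play w n := next_round (state w n) (w n).

Let state_play w n : (state w n).1 = mkseq (induced_play w) n.
Proof. by elim: n => // n IH; rewrite mkseqS -IH. Qed.

Let induced_follows w : valid w -> follows S (induced_play w).
Proof.
move=> vw; split=> n; last by rewrite -state_play.
by rewrite -state_play; have [] := legal_state_valid n vw.
Qed.

Let valid_sub w n : valid w -> w n `<=` (induced_play w n).2.
Proof. by move=> /(_ n)/move_good[]. Qed.

Let play_sub w n : valid w -> (induced_play w n.+1).2 `<=` w n.
Proof.
move=> vw; have [pP _] := induced_follows vw.
have [_ [_ _ VU]] := play_legal n.+1 pP; apply: subset_trans VU _.
by have [_ _] := move_good (vw n.+1).
Qed.

Let valid_decr w k n : valid w -> k <= n -> w n `<=` w k.
Proof.
move=> vw; elim: n => [|n IH]; first by rewrite leqn0 => /eqP->.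
rewrite leq_eqVlt => /predU1P[->//|/IH kn]; apply: subset_trans kn.
by apply: subset_trans (play_sub vw); exact: valid_sub.
Qed.

Let valid_nbhs w x (A : set X) : valid w -> (\bigcap_n w n) x -> nbhs x A ->
  exists n, w n `<=` A.
Proof.
move=> vw wx xA; have Vx : (\bigcap_n (induced_play w n).2) x.
  by move=> n _; apply: valid_sub => //; exact: wx.
have [_ /(_ _ xA)[_ [n _ <-] nA]] := Sconv (induced_follows vw) Vx.
by exists n; apply: subset_trans nA; exact: valid_sub.
Qed.

Let limit w := xget x0 (\bigcap_n w n).

Let limitP w : valid w -> (\bigcap_n w n) (limit w).
Proof.
move=> vw; apply: xgetPex; have [x Vx] := Swin (induced_follows vw).
by exists x => n _; apply: play_sub => //; exact: Vx.
Qed.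

Let limit_unique w x : valid w -> (\bigcap_n w n) x -> limit w = x.
Proof.
move=> vw wx; apply/eqP; apply: contrapT => /negP/hX.
move=> [A [oA /set_mem Al /set_mem]].
have [n nA] := valid_nbhs vw (limitP vw) (open_nbhs_nbhs (conj oA Al)).
by apply; apply: nA; exact: wx.
Qed.

(** Beyond the prefix, an admissible set containing [x] is picked at every step; [x] is then the
    limit. *)
Let extend n w x : (forall k, k < n -> admissible (state w k) (w k)) ->
  (state w n).2 x -> exists v, [/\ valid v, agree n w v & limit v = x].
Proof.
move=> wa wx.
pose pick st := xget setT [set W | admissible st W /\ W x].
(* A pick depends on the current state, so the states are built first and the sequence is read off
   from them. *)
pose fix T k := if k is i.+1
  then update (T i) (if i < n then w i else pick (T i)) else ([::], [set: X]).
pose v k := if k < n then w k else pick (T k).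
have vT k : state v k = T k by elim: k => //= k ->.
have wv : agree n w v by move=> k; rewrite /v => ->.
have wvk k : k <= n -> state w k = state v k.
  by move=> kn; apply: state_agree => i ik; apply: wv; exact: leq_trans kn.
have vx k : legal_state (state v k) -> (n <= k -> (state v k).2 x) ->
    admissible (state v k) (v k) /\ (n <= k -> v k x).
  have [kn _ _|nk Lk /(_ isT) kx] := ltnP k n.
    by rewrite -wvk ?(ltnW kn)// -wv//; split=> //; exact: wa.
  have [W aW Wx] := admissible_exists Lk kx.
  have [] : admissible (state v k) (v k) /\ v k x; last by [].
  rewrite {2 3}/v ltnNge nk /= -vT.
  by apply: (@xgetPex _ _ [set W | admissible (state v k) W /\ W x]); exists W.
have inv k : legal_state (state v k) /\ (n <= k -> (state v k).2 x).
  elim: k => [|k [Lk kx]].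
    split; first exact: (legal_state0 v).
    by rewrite leqn0 => /eqP n0; move: wx; rewrite n0.
  have [ak vk] := vx k Lk kx; split; first exact: legal_update.
  (* At [n = k.+1] the state is still that of [w], and [wx] applies. *)
  by rewrite leq_eqVlt => /predU1P[nk|/vk//]; rewrite -nk -wvk.
have vv : valid v by move=> k; have [Lk kx] := inv k; exact: (vx k Lk kx).1.
exists v; split=> //; apply: limit_unique => // k _.
apply: (valid_decr vv (leq_addr n k)); have [Lk kx] := inv (k + n).
by apply: (vx _ Lk kx).2; exact: leq_addl.
Qed.

Let M : metricType R := seq_space R valid.

Let f (w : M) := limit (sval w).

(** Validity is closed: its clause at index [n] depends only on the first [n.+1] terms. *)
Let M_complete : complete_metric M.
Proof.
apply: seq_space_complete => w wv n; have [v vv] := wv n.+1.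
move=> agr; rewrite agr// (state_agree (v := v)); first exact: vv.
by move=> k kn; apply: agr; exact: ltnW.
Qed.

Let f_continuous : continuous f.
Proof.
move=> w A /(valid_nbhs (svalP w) (limitP (svalP w)))[n nA].
apply/nbhs_seq_space; exists n.+1 => v wv; apply: nA; rewrite wv//.
exact: (limitP (svalP v)).
Qed.

(** By [extend], the image of the cylinder of length [n] around [w] contains the open set
    [(state (sval w) n).2], to which [f w] belongs. *)
Let f_open A : open A -> open (f @` A).
Proof.
rewrite !openE => oA _ [w Aw <-].
have [n nA] := (nbhs_seq_space w A).1 (oA _ Aw).
have [_ on _] := legal_state_valid n (svalP w).
have nw : (state (sval w) n).2 (f w).
  by case: (n) => // k; exact: (limitP (svalP w)).
apply: filterS (open_nbhs_nbhs (conj on nw)) => x wx.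
have [v [vv wv <-]] := extend (fun k _ => svalP w k) wx.
by exists (exist _ v vv) => //; exact: nA.
Qed.

Let f_surj : set_surj [set: M] [set: X] f.
Proof.
(* The prefix is empty, so the sequence passed to [extend] is arbitrary. *)
move=> x _; have [//|//|v [vv _ <-]] := @extend 0 (fun=> setT) x.
by exists (exist _ v vv).
Qed.

Let cylinder (s : seq (set X)) : set M := [set w | mkseq (sval w) (size s) = s].

Let cylinder_basis :
  basis (cylinder @` [set s | forall U, U \in s -> B U]).
Proof.
apply: nbhs_basis => [_ [s _ <-]|w A /nbhs_seq_space[n nA]].
  rewrite openE => w <-; apply/nbhs_seq_space; exists (size s) => v wv.
  by rewrite /cylinder /= size_mkseq; apply/eq_in_map => k;
    rewrite mem_iota => /wv.
exists (cylinder (mkseq (sval w) n)); split.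
- exists (mkseq (sval w) n) => // U /mapP[k _ ->]; exact: (svalP w k).1.
- by rewrite /cylinder /= size_mkseq.
- move=> v; rewrite /cylinder /= size_mkseq => vw; apply: nA => k kn.
  by rewrite -(nth_mkseq setT _ kn) -vw nth_mkseq.
Qed.

Lemma strategy_metric_image :
  infinite_set B -> (forall B' : set (set X), basis B' -> B #<= B') ->
  exists (M : metricType R) (f : M -> X),
    [/\ complete_metric M, open_continuous_surjection f & same_weight M X].
Proof.
move=> Binf Bmin; have fP : open_continuous_surjection f by split.
exists M, f; split=> //; apply: same_weight_image fP bB Bmin cylinder_basis _.
apply: (@card_le_trans _ _ _ [set s : seq (set X) | forall U, U \in s -> B U]).
  exact: card_image_le.
exact: card_seq_le.
Qed.

End MetricFromStrategy.

Theorem theorem3 (R : realType) (X : topologicalType)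
    (hX : accessible_space X) :
  ((exists (M : metricType R) (f : M -> X),
      complete_metric M /\ open_continuous_surjection f)
   <-> has_convergent_winning_strategy X)
  /\
  (has_convergent_winning_strategy X ->
   exists (M : metricType R) (f : M -> X),
     [/\ complete_metric M, open_continuous_surjection f & same_weight M X]).
Proof.
suff main : has_convergent_winning_strategy X ->
   exists (M : metricType R) (f : M -> X),
     [/\ complete_metric M, open_continuous_surjection f & same_weight M X].
  split=> //; split=> [[M [f [Mc fP]]]|/main[M [f [Mc fP _]]]];
    last by exists M, f.
  exact: complete_metric_strategy hX Mc fP.
move=> [S [Slegal Sconv Swin]].
have [B [bB Bmin]] := exists_minimum_basis X.
(* The discrete case includes the empty space. Otherwise a point that is not isolated serves as
   default point and forces [B] to be infinite. *)
have [discr|/existsNP[x0 nx0]] := pselect (forall x : X, open [set x]).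
  exact: discrete_metric_image discr _ bB Bmin.
apply: (strategy_metric_image R x0 hX Slegal Sconv Swin bB) => // Bfin.
by apply: nx0; exact: finite_basis_discrete hX bB Bfin x0.
Qed.
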